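(* Let $X$ be a Hilbert space, let $p\in[1,+\infty[$, let $\Omega\subset X$, and let $f\in\Gamma_0(X)$ be such that $\operatorname{argmin} f\neq\emptyset$. Consider the following properties: (i) $f$ is $p$-conditioned on $\Omega$ (with constant $\gamma_{f,\Omega}$); (ii) $\partial f$ is $p$-metrically subregular on $\Omega$ (with constant $\gamma_{\partial f,\Omega}$); (iii) $f$ is $p$-Łojasiewicz on $\Omega$ (with constant $c_{f,\Omega}$). Then (i) $\Rightarrow$ (ii) $\Rightarrow$ (iii). One can respectively take $\gamma_{\partial f,\Omega}=\gamma_{f,\Omega}/p$ and $c_{f,\Omega}=\gamma_{\partial f,\Omega}^{-1/p}$. Assuming in addition that $\Omega$ is $\partial f$-invariant, we also have (iii) $\Rightarrow$ (i), with $\gamma_{f,\Omega}=c_{f,\Omega}^{-p}\,p^{1-p}$.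
   Context: $\Gamma_0(X)$ is the set of proper, convex, lower semicontinuous functions $X\to]-\infty,+\infty]$; $\partial f$ is the convex (Fenchel) subdifferential; $\operatorname{dom} f$ and $\operatorname{dom}\partial f$ are the effective domains of $f$ and $\partial f$; $\operatorname{dom}^*f:=\operatorname{dom} f\setminus\operatorname{argmin} f$; $\|\partial f(x)\|_-:=\operatorname{dist}(0,\partial f(x))$, equal to $+\infty$ if $\partial f(x)=\emptyset$. For $f\in\Gamma_0(X)$ with $\operatorname{argmin} f\ne\emptyset$: - $f$ is $p$-conditioned on $\Omega$ if there exists a constant $\gamma_{f,\Omega}>0$ such that $\frac{\gamma_{f,\Omega}}{p}\operatorname{dist}(x,\operatorname{argmin} f)^p\le f(x)-\inf f$ for all $x\in\Omega\cap\operatorname{dom} f$. - $\partial f$ is $p$-metrically subregular on $\Omega$ if there exists a constant $\gamma_{\partial f,\Omega}>0$ such that $\gamma_{\partial f,\Omega}\operatorname{dist}(x,\operatorname{argmin} f)^{p-1}\le\|\partial f(x)\|_-$ for all $x\in\Omega\cap\operatorname{dom}^*f$. - $f$ is $p$-Łojasiewicz on $\Omega$ if there exists a constant $c_{f,\Omega}>0$ such that $(f(x)-\inf f)^{1-1/p}\le c_{f,\Omega}\|\partial f(x)\|_-$ for all $x\in\Omega\cap\operatorname{dom}^*f$. For $u_0\in\operatorname{dom} f$, $u(\cdot;u_0):[0,+\infty[\to X$ denotes the steepest descent trajectory, i.e. the unique absolutely continuous trajectory with $u(0;u_0)=u_0$ and $\frac{d}{dt}u(t;u_0)+\partial f(u(t;u_0))\ni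 0$ for a.e. $t>0$. A set $\Omega\subset X$ is $\partial f$-invariant if for any $x\in\Omega\cap\operatorname{dom}\partial f$ and a.e. $t>0$, $u(t;x)\in\Omega$ holds.
   Formalization: As printed, (iii) ⇒ (i) fails at points of Ω in dom f but outside dom ∂f (f = −√x on [0,1], Ω = {0}); proved instead: ∂f-invariance gives (i) on Ω ∩ dom ∂f, and invariance under trajectories from all of Ω ∩ dom f gives (i) on Ω. *)

(* Defs.v *)
From mathcomp Require Import all_boot all_order all_algebra.
From mathcomp Require Import all_classical all_reals all_analysis.
Set Implicit Arguments.
Unset Strict Implicit.
Unset Printing Implicit Defensive.
Import Order.TTheory GRing.Theory Num.Theory.
Import numFieldNormedType.Exports.
Local Open Scope classical_set_scope.
Local Open Scope ring_scope.

Section hilbert.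
Context {R : realType} {X : completeNormedModType R}.

(* A (real) Hilbert space is a complete normed module together with a symmetric
   positive definite bilinear form inducing its norm. *)
Definition hilbert_dot (dot : {dot X for (@idfun R)}) : Prop :=
  forall x, dot x x = `|x| ^+ 2.

Lemma edist_norm (x y : X) : edist (x, y) = `|x - y|%:E.
Proof.
apply/eqP; rewrite eq_le; apply/andP; split.
  apply/lee_addgt0Pr => e e0; rewrite -EFinD.
  apply: edist_fin => /=; first by rewrite ltr_wpDl.
  by rewrite -ball_normE /ball_ /= ltrDl.
apply: le_ereal_inf_tmp => _ /= [r [r0 +] <-].
by rewrite -ball_normE /ball_ /= lee_fin => /ltW.
Qed.

End hilbert.

Section extended_functions.
Context {R : realType} {X : completeNormedModType R}.
Implicit Types (f : X -> \bar R) (x : X).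
Local Open Scope ereal_scope.

Definition dom f : set X := [set x | f x < +oo].

Definition proper f : Prop := (forall x, f x != -oo) /\ dom f !=set0.

(* For proper f the right-hand side is never of the form +oo - oo, and at the
   endpoints t = 0, 1 the convention 0 * +oo = 0 makes it a tautology. *)
Definition convex f : Prop :=
  forall (x y : X) (t : R), (0 <= t <= 1)%R ->
    f (t *: x + (1 - t) *: y)%R <= t%:E * f x + (1 - t)%:E * f y.

Definition Gamma0 f : Prop :=
  [/\ proper f, convex f & lower_semicontinuous f].

Definition inf_val f : \bar R := ereal_inf (range f).

Definition argmin f : set X := [set x | forall y, f x <= f y].

Definition dom_star f : set X := dom f `\` argmin f.

(* p-conditioning on Om with constant g *)
Definition conditioned_with f (p : R) (Om : set X) (g : R) : Prop :=
  (0 < g)%R /\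
  forall x, Om x -> dom f x ->
    (g / p)%:E * edist_inf (argmin f) x `^ p <= f x - inf_val f.

Definition conditioned f (p : R) (Om : set X) : Prop :=
  exists g, conditioned_with f p Om g.

End extended_functions.

Section subdifferential.
Context {R : realType} {X : completeNormedModType R}.
Variable dot : {dot X for (@idfun R)}.
Implicit Types (f : X -> \bar R) (x : X) (u : R -> X).
Local Open Scope ereal_scope.

(* For proper f this is empty outside dom f. *)
Definition subdiff f x : set X :=
  [set v | forall y, f x + (dot v (y - x)%R)%:E <= f y].

Definition dom_subdiff f : set X := [set x | subdiff f x !=set0].

(* dist (0, subdiff f x); it is +oo when the subdifferential is empty since
   ereal_inf set0 = +oo. *)
Definition slope f x : \bar R := edist_inf (subdiff f x) 0%R.

Definition subregular_with f (p : R) (Om : set X) (g : R) : Prop :=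
  (0 < g)%R /\
  forall x, Om x -> dom_star f x ->
    g%:E * edist_inf (argmin f) x `^ (p - 1)%R <= slope f x.

Definition subregular f (p : R) (Om : set X) : Prop :=
  exists g, subregular_with f p Om g.

Definition lojasiewicz_with f (p : R) (Om : set X) (c : R) : Prop :=
  (0 < c)%R /\
  forall x, Om x -> dom_star f x ->
    (f x - inf_val f) `^ (1 - p^-1)%R <= c%:E * slope f x.

Definition lojasiewicz f (p : R) (Om : set X) : Prop :=
  exists c, lojasiewicz_with f p Om c.

Definition absolutely_continuous_on (a b : R) u : Prop :=
  forall e : R, (0 < e)%R -> exists2 d : R, (0 < d)%R &
    forall (n : nat) (s t : 'I_n -> R),
      (forall i, a <= s i /\ s i <= t i /\ t i <= b)%R ->
      (forall i j, i != j -> `]s i, t i[ `&` `]s j, t j[ = set0) ->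
      (\sum_(i < n) (t i - s i) < d)%R ->
      (\sum_(i < n) `|u (t i) - u (s i)| < e)%R.

(* As usual, absolute continuity on [0, +oo[ means absolute continuity on
   every compact subinterval; the values of u at negative times are irrelevant. *)
Definition steepest_descent f (u0 : X) u : Prop :=
  [/\ u 0%R = u0,
      forall T : R, (0 < T)%R -> absolutely_continuous_on 0 T u
    & {ae @lebesgue_measure R, forall t : R, (0 < t)%R ->
        derivable u t 1 /\ subdiff f (u t) (- 'D_1 u t)%R}].

(* The trajectory starting at a given point of dom f exists and is unique on
   [0, +oo[; "exists u" thus refers to that trajectory. *)
Definition flow_invariant_from f (D Om : set X) : Prop :=
  forall x, Om x -> D x ->
    exists2 u, steepest_descent f x u &
      {ae @lebesgue_measure R, forall t : R, (0 < t)%R -> Om (u t)}.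

Definition subdiff_invariant f (Om : set X) : Prop :=
  flow_invariant_from f (dom_subdiff f) Om.

(* subdiff_invariant says nothing about the points of Om in
   dom f `\` dom_subdiff f, where the slope is +oo and the Lojasiewicz inequality
   is void as well. Example: on the real line, f x = - sqrt x on [0, 1], +oo
   elsewhere, Om = [set 0]: Om is subdiff_invariant and f is p-Lojasiewicz on Om
   with every constant c > 0, whereas f is p-conditioned on Om with constant g only
   if g <= p. To get conditioning on all of Om, trajectories have to
   stay in Om from every starting point in dom f. *)
Definition dom_invariant f (Om : set X) : Prop :=
  flow_invariant_from f (dom f) Om.

End subdifferential.

(* Main.v *)
Require Import Defs.
From mathcomp Require Import all_boot all_order all_algebra.
From mathcomp Require Import all_classical all_reals all_analysis.
From mathcomp Require Import ring lra.
Import Order.TTheory GRing.Theory Num.Theory.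
Import numFieldNormedType.Exports.
Local Open Scope classical_set_scope.
Local Open Scope ring_scope.

Set Implicit Arguments.
Unset Strict Implicit.
Unset Printing Implicit Defensive.

(** The first two implications are pointwise.  For [v] in the subdifferential of
[f] at [x], the subgradient inequality tested at minimizers and Cauchy-Schwarz give
[f x - inf f <= |v| * dist (x, argmin f)] ([dom_starP]).  Dividing the
conditioning inequality by the distance yields subregularity, and eliminating the
distance between this bound and subregularity yields the Lojasiewicz inequality.

For the last implication, put [h t := f (u t) - inf f] along the trajectory [u] from
[x] and [phi r := p * c * r `^ p^-1].  Formally, [h' = - |u'|^2], and the
Lojasiewicz inequality reads [phi' (h t) * |u'| >= 1] because [- u'] is a
subgradient; hence [(phi \o h)' <= - |u'|], so the trajectory has length at most
[phi (h 0)], it converges, and its limit is a minimizer.  Thus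
[dist (x, argmin f) <= phi (f x - inf f)], which is conditioning with the announced
constant.

The rigorous argument avoids differentiating [f \o u].  Everything rests on one
growth principle ([left_slope_growth]): a function whose
increases are dominated by the displacement of an absolutely continuous curve,
and whose upper left slope is at most [l] almost everywhere, grows at most at rate
[l].
- Applied to [|u t - y|^2] it gives the evolution variational inequality
  ([descent_variational]).
- That inequality, started from the last time at which [f \o u] is below a given
  level, shows with lower semicontinuity that [f \o u] is nonincreasing
  ([descent_nonincreasing]); tested at a minimizer it gives [h t = O(1/t)]
  ([gap_decay]).
- Applied to [|u t - u s| + phi (h t)], whose increases are dominated by the
  displacement of [u] precisely because [h] is nonincreasing, it gives the length
  estimate ([descent_length]).  The slope bound there only uses the
  subgradient inequality at [u t] tested at the earlier points [u s], which is why
  left slopes suffice. *)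

(** * The inner product of a Hilbert space *)

Section inner_product.
Context {R : realType} {X : completeNormedModType R}.
Variable dot : {dot X for (@idfun R)}.
Hypothesis hdot : hilbert_dot dot.
Implicit Types (x y z : X) (a : R).

Lemma dotC x y : dot x y = dot y x.
Proof. by rewrite hermC expr0 mul1r. Qed.

Lemma dotDl x y z : dot (x + y) z = dot x z + dot y z.
Proof. exact: linearDl. Qed.

Lemma dotDr x y z : dot z (x + y) = dot z x + dot z y.
Proof. exact: linearDr. Qed.

Lemma dotNr x y : dot x (- y) = - dot x y.
Proof. exact: linearNr. Qed.

Lemma dotNl x y : dot (- x) y = - dot x y.
Proof. by rewrite dotC dotNr dotC. Qed.

Lemma dotZl a x y : dot (a *: x) y = a * dot x y.
Proof. exact: linearZl_LR. Qed.

Lemma dotZr a x y : dot x (a *: y) = a * dot x y.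
Proof. by rewrite dotC dotZl dotC. Qed.

Lemma normD_sqr x y : `|x + y| ^+ 2 = `|x| ^+ 2 + 2 * dot x y + `|y| ^+ 2.
Proof.
rewrite -!hdot dotDl !dotDr (dotC y x) -!addrA; congr (_ + _).
by rewrite mulr_natl mulr2n addrA.
Qed.

(** Cauchy-Schwarz, read off from [0 <= | |y| x - |x| y |^2]. *)
Lemma dot_le_norm x y : dot x y <= `|x| * `|y|.
Proof.
have [->|y0] := eqVneq y 0.
  by rewrite normr0 mulr0 -(scale0r (0 : X)) dotZr mul0r.
have ny : 0 < `|y| by rewrite normr_gt0.
have [->|x0] := eqVneq x 0.
  by rewrite normr0 mul0r -(scale0r (0 : X)) dotZl mul0r.
have nx : 0 < `|x| by rewrite normr_gt0.
have := sqr_ge0 `| `|y| *: x + (- `|x|) *: y |.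
rewrite normD_sqr dotZl dotZr !normrZ normrN !normr_id => H.
have {H} : 0 <= 2 * (`|x| * `|y|) * (`|x| * `|y| - dot x y).
  by apply: le_trans H _; rewrite le_eqVlt; apply/orP; left; apply/eqP; ring.
by rewrite pmulr_rge0 ?subr_ge0// !mulr_gt0.
Qed.

End inner_product.

(** * Intervals and Lebesgue null sets *)

Section lebesgue_null_sets.
Context {R : realType}.
Local Notation mu := (@lebesgue_measure R).

Lemma sum_itv_length_le (n : nat) (s t : 'I_n -> R) (U : set R) :
    measurable U ->
    (forall i, s i <= t i) ->
    (forall i j, i != j -> `]s i, t i[ `&` `]s j, t j[ = set0) ->
    (forall i, `]s i, t i[ `<=` U) ->
  ((\sum_(i < n) (t i - s i))%:E <= mu U)%E.
Proof.
move=> mU st dis sub.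
have -> : ((\sum_(i < n) (t i - s i))%:E = \sum_(i < n) mu `]s i, t i[)%E.
  rewrite -sumEFin; apply: eq_bigr => i _.
  rewrite lebesgue_measure_itv /= lte_fin; have := st i; rewrite le_eqVlt.
  by move=> /predU1P[->|->]; rewrite ?ltxx ?subrr.
rewrite -(measure_bigsetU_ord _ xpredT) => [|i|]; first last.
- by apply/trivIsetP => i j _ _; exact: dis.
- exact: measurable_itv.
apply: le_measure; rewrite ?inE//.
  by apply: bigsetU_measurable => i _; exact: measurable_itv.
apply: (big_ind (fun A => A `<=` U)) => // A B AU BU.
by rewrite subUset.
Qed.

(** The almost-everywhere filter, at the form of [lebesgue_measure] for which
the lemmas on filters look it up. *)
#[export] Instance ae_lebesgue_filter :
  Filter (nbhs (almost_everywhere mu)).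
Proof. exact: ae_filter_ringOfSetsType. Qed.

(** Outer regularity: the exceptional null set fits in an open set of small
measure, to which absolute continuity can be applied. *)
Lemma ae_outer_open (P : set R) (d : R) : {ae mu, forall t, P t} -> 0 < d ->
  exists U : set R, [/\ open U, (mu U < d%:E)%E & forall t, ~ U t -> P t].
Proof.
move=> [N [mN N0 PN]] d0.
have [|U [oU NU Ud]] := @lebesgue_regularity_outer R N d mN _ d0.
  by apply: (@le_lt_trans _ _ 0%E) => //; rewrite le_eqVlt; apply/orP; left; apply/eqP.
exists U; split => //.
  have mU : measurable U by exact: measurable_realfun.open_measurable.
  have UN0 : mu (U `&` N) = 0%E.
    by apply: (subset_measure0 _ mN _ N0) => //; exact: measurableI.
  have -> : (mu U = mu (U `\` N) + mu (U `&` N))%E.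
    exact: measureDI.
  by rewrite [X in (_ + X < _)%E]UN0 adde0.
by move=> t Ut; apply: contrapT => nP; apply/Ut/NU/PN.
Qed.

End lebesgue_null_sets.

(** * Growth of functions controlled by an absolutely continuous curve *)

Section absolute_continuity.
Context {R : realType} {X : completeNormedModType R}.
Local Notation mu := (@lebesgue_measure R).
Implicit Types (u : R -> X) (U : set R) (a b : R).

Lemma absolutely_continuous_onS a b a' b' u : a <= a' -> b' <= b ->
  absolutely_continuous_on a b u -> absolutely_continuous_on a' b' u.
Proof.
move=> aa' bb' uac e /uac[d d0 H]; exists d => // n s t st dis sd.
apply: H => // i; have [? [? ?]] := st i; split; first exact: le_trans aa' _.
by split => //; exact: le_trans bb'.
Qed.

Lemma absolutely_continuous_on_unif a b u (e : R) :
  absolutely_continuous_on a b u -> 0 < e -> exists2 d : R, 0 < d &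
    forall s t, a <= s -> s <= t -> t <= b -> t - s < d -> `|u t - u s| < e.
Proof.
move=> uac /uac[d d0 H]; exists d => // s t ? ? ? std.
have /= := H 1 (fun=> s) (fun=> t); rewrite !big_ord1; apply => //.
by move=> i j; rewrite (ord1 i) (ord1 j) eqxx.
Qed.

(** The modulus of continuity for increments [1], chained over steps of length
[d / 2]. *)
Lemma absolutely_continuous_on_bounded a b u :
  absolutely_continuous_on a b u -> exists2 M : R, 0 <= M &
    forall t, a <= t -> t <= b -> `|u t - u a| <= M.
Proof.
move=> uac.
have [d d0 ud] := absolutely_continuous_on_unif uac (@ltr01 R).
have step (k : nat) t : a <= t -> t <= b -> t <= a + k%:R * (d / 2) ->
    `|u t - u a| <= k%:R.
  elim: k t => [|k IH] t at_ tb.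
    rewrite mul0r addr0 => ta; have -> : t = a by apply/eqP; rewrite eq_le ta.
    by rewrite subrr normr0.
  move=> tk; have [ta|ta] := leP t (a + d / 2).
    have := ud a t (lexx _) at_ tb; rewrite -natr1 => /(_ _)/ltW H.
    by apply: le_trans (H _) _; [lra|rewrite lerDr ler0n].
  have H1 : `|u (t - d / 2) - u a| <= k%:R.
    apply: IH; [lra|lra|]; move: tk; rewrite -natr1 mulrDl; lra.
  have H2 : `|u t - u (t - d / 2)| < 1 by apply: ud; lra.
  rewrite -natr1 -(subrK (u (t - d / 2)) (u t)) -addrA addrC.
  by apply: le_trans (ler_normD _ _) _; rewrite lerD// ltW.
have [k kP] : exists k : nat, (b - a) / (d / 2) <= k%:R.
  exists (Num.bound `|(b - a) / (d / 2)|).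
  by rewrite (le_trans (ler_norm _))// ltW// archi_boundP.
exists k%:R => // t at_ tb; apply: (step k t) => //.
move: kP; rewrite ler_pdivrMr ?divr_gt0//; lra.
Qed.

Definition disjoint_intervals U a b (n : nat) (s t : 'I_n -> R) : Prop :=
  [/\ forall i, a <= s i /\ s i <= t i /\ t i <= b,
      forall i j, i != j -> `]s i, t i[ `&` `]s j, t j[ = set0
    & forall i, `]s i, t i[ `<=` U].

(** The sums contain the lengths of the intervals besides the displacements of
[u]: in [left_slope_growth] this pays for the rate [l], possibly negative, on
the exceptional intervals. *)
Definition variation_sums u U b a : set R :=
  [set v | exists n (s t : 'I_n -> R), disjoint_intervals U a b s t /\
     v = \sum_(i < n) (`|u (t i) - u (s i)| + (t i - s i))].

Definition variation u U b a : R := sup (variation_sums u U b a).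

Lemma variation_sums0 u U b a : variation_sums u U b a 0.
Proof.
exists 0%N, (fun=> 0), (fun=> 0); rewrite big_ord0; split => //.
by split; case.
Qed.

Lemma variation_sums_cons u U b s t v : s <= t -> t <= b -> `]s, t[ `<=` U ->
  variation_sums u U b t v -> variation_sums u U b s (`|u t - u s| + (t - s) + v).
Proof.
move=> st tb stU [n [s0 [t0 [[ord dis sub] ->]]]].
pose cons (x : R) (y : 'I_n -> R) (i : 'I_n.+1) :=
  if unlift ord0 i is Some j then y j else x.
exists n.+1, (cons s s0), (cons t t0); split; last first.
  rewrite big_ord_recl /cons unlift_none; congr (_ + _).
  by apply: eq_bigr => i _; rewrite liftK.
split.
- move=> i; rewrite /cons; case: unliftP => // j _.
  by have [? [? ?]] := ord j; split => //; exact: le_trans st _.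
- have stdis j : `]s, t[ `&` `]s0 j, t0 j[ = set0.
    apply/seteqP; split => // x [] /=; rewrite !in_itv /= => /andP[_ xt].
    by move=> /andP[sx _]; have [ts _] := ord j; lra.
  move=> i j; rewrite /cons.
  case: (unliftP ord0 i) => [i'|] ->; case: (unliftP ord0 j) => [j'|] -> //.
  + by rewrite (inj_eq lift_inj) => /dis.
  + by move=> _; rewrite setIC.
- by move=> i; rewrite /cons; case: unliftP.
Qed.

Lemma variation_sumsS u U b s t : s <= t ->
  variation_sums u U b t `<=` variation_sums u U b s.
Proof.
move=> st v [n [s0 [t0 [[ord dis sub] ->]]]]; exists n, s0, t0; split => //.
split => // i; have [? [? ?]] := ord i; split => //; exact: le_trans st _.
Qed.

(** Let [U] be an open set of small measure outside of which the slope bound holds, and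
[V r] the variation of [u] over intervals of [U] to the right of [r]; absolute
continuity makes [V] small.  Going down from [b], the estimate
[g b - g r <= (l + e) * (b - r) + K' * V r] persists: at a point outside [U] the
slope bound extends it to the left, inside [U] the increase of [V] does, and it
passes to the infimum [m] of the points where it holds because the increments of
[g] are controlled by those of [u].  Hence it holds at [a]. *)
Lemma left_slope_growth u a b (K l : R) (g : R -> R) :
    a <= b -> absolutely_continuous_on a b u -> 0 <= K ->
    (forall s t, a <= s -> s <= t -> t <= b -> g t - g s <= K * `|u t - u s|) ->
    {ae mu, forall t, a < t -> t <= b -> forall e, 0 < e ->
      \forall s \near t^'-, g t - g s <= (l + e) * (t - s)} ->
  g b - g a <= l * (b - a).
Proof.
move=> ab uac K0 gK aeg; apply/ler_addgt0Pr => e0 e00.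
pose K' := K + `|l|.
have l0 := normr_ge0 l.
have K'0 : 0 <= K' by rewrite addr_ge0.
pose e := e0 / (b - a + 2 * K' + 1).
have e_gt0 : 0 < e by rewrite divr_gt0//; lra.
have ee0 : e * (b - a + 2 * K' + 1) = e0 by rewrite divfK//; lra.
suff : g b - g a <= (l + e) * (b - a) + K' * (2 * e) by nra.
have [d d0 acd] := uac e e_gt0.
have de0 : 0 < Num.min d e by rewrite lt_min d0.
have [U [oU Ud Ugood]] := ae_outer_open aeg de0.
have mU : measurable U by exact: measurable_realfun.open_measurable.
pose V r := variation u U b r.
have Vub r : a <= r -> ubound (variation_sums u U b r) (2 * e).
  move=> ar v [n [s [t [[ord dis sub] ->]]]]; rewrite big_split/=.
  have : \sum_(i < n) (t i - s i) < Num.min d e.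
    rewrite -lte_fin; apply: le_lt_trans Ud.
    by apply: sum_itv_length_le => // i; have [_ []] := ord i.
  rewrite lt_min => /andP[/acd sd se]; rewrite mulr_natl mulr2n.
  apply: lerD; apply: ltW => //; apply: sd => //.
  by move=> i; have [? [? ?]] := ord i; split => //; exact: le_trans ar _.
have Vhas r : a <= r -> has_sup (variation_sums u U b r).
  by move=> ar; split; [exists 0; exact: variation_sums0|exists (2 * e); exact: Vub].
have VS s t : a <= s -> s <= t -> V t <= V s.
  move=> as_ st; apply: ge_sup; first by exists 0; exact: variation_sums0.
  by move=> v /(variation_sumsS st); apply: ub_le_sup; have [] := Vhas s as_.
have Vcons s t : a <= s -> s <= t -> t <= b -> `]s, t[ `<=` U ->
    `|u t - u s| + (t - s) + V t <= V s.
  move=> as_ st tb stU; rewrite -lerBrDl.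
  apply: ge_sup; first by exists 0; exact: variation_sums0.
  move=> v /(variation_sums_cons st tb stU) Hv; rewrite lerBrDl.
  by apply: ub_le_sup Hv; have [] := Vhas s as_.
pose A := [set r | [/\ a <= r, r <= b &
                        g b - g r <= (l + e) * (b - r) + K' * V r]].
have V0 r : a <= r -> 0 <= V r.
  move=> ar; apply: ub_le_sup; first by have [] := Vhas r ar.
  exact: variation_sums0.
have Ab : A b.
  by split => //; rewrite !subrr mulr0 add0r mulr_ge0// V0.
have lbA : lbound A a by move=> r [].
have infA : has_inf A by split; [exists b|exists a].
pose m := inf A.
have am : a <= m by apply: lb_le_inf => //; exists b.
have mb : m <= b by apply: ge_inf Ab; exists a.
(* [V] is not continuous, but it is nonincreasing, so [V r <= V m] for [r] in
   [A] near [m]. *)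
have Am : A m.
  split => //; apply/ler_addgt0Pr => h h0.
  have K1 : 0 < 2 * (K + 1) by lra.
  have L1 : 0 < 2 * (`|l + e| + 1) by rewrite mulr_gt0// ltr_wpDl.
  have [d1 d10 ud1] := absolutely_continuous_on_unif uac (divr_gt0 h0 K1).
  have d2 : 0 < Num.min d1 (h / (2 * (`|l + e| + 1))).
    by rewrite lt_min d10 divr_gt0.
  have [r Ar] := inf_adherent d2 infA.
  rewrite -ltrBlDl lt_min => /andP[rd1 rd2].
  have mr : m <= r by apply: ge_inf Ar; exists a.
  have [ar rb gr] := Ar.
  have ur := ud1 _ _ am mr rb rd1.
  have grm := gK _ _ am mr rb.
  have Vrm : K' * V r <= K' * V m by rewrite ler_wpM2l// VS.
  have H1 : K * `|u r - u m| <= h / 2.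
    have : K * `|u r - u m| <= K * (h / (2 * (K + 1))).
      by rewrite ler_wpM2l// ltW.
    move/le_trans; apply.
    rewrite mulrA ler_pdivrMr//; nra.
  have H2 : `|l + e| * (r - m) <= h / 2.
    have : `|l + e| * (r - m) <= `|l + e| * (h / (2 * (`|l + e| + 1))).
      by rewrite ler_wpM2l// ltW.
    move/le_trans; apply.
    rewrite mulrA ler_pdivrMr//; have := normr_ge0 (l + e); nra.
  have H3 : (- (l + e)) * (r - m) <= `|l + e| * (r - m).
    by rewrite ler_wpM2r ?subr_ge0// -normrN ler_norm.
  by lra.
have {}am : m = a.
  apply/eqP; rewrite eq_le am andbT leNgt; apply/negP => ltam.
  suff [s [as_ sm As]] : exists s, [/\ a <= s, s < m & A s].
    by have : m <= s by [apply: ge_inf As; exists a]; rewrite leNgt sm.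
  have [_ _ gm] := Am.
  have [Um|nUm] := pselect (U m).
    have /nbhs_ballP[r /= r0 rU] : nbhs m U by exact: open_nbhs_nbhs.
    have ms : Num.max a (m - r) < m by rewrite gt_max ltam/= ltrBlDr ltrDl.
    have as_ : a <= Num.max a (m - r) by rewrite le_max lexx.
    exists (Num.max a (m - r)); split => //; split => //; first lra.
    have : `]Num.max a (m - r), m[ `<=` U.
      move=> x /=; rewrite in_itv/= gt_max => /andP[/andP[_ mx] xm].
      by apply: rU; rewrite /ball/= ger0_norm; lra.
    move=> /(Vcons _ _ as_ (ltW ms) mb); move/(ler_wpM2l K'0).
    have := gK _ _ as_ (ltW ms) mb.
    have := ler_norm (- l); rewrite normrN.
    move: as_ ms; set s := Num.max _ _ => as_ ms nl.
    set D := `|u m - u s| => H1.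
    have D0 : 0 <= D := normr_ge0 _.
    rewrite /K' in gm *; move: gm; set V1 := V m; set V2 := V s => gm.
    have ld0 : 0 <= `|l| * D by rewrite mulr_ge0.
    have lms : - l * (m - s) <= `|l| * (m - s) by rewrite ler_wpM2r; lra.
    have ems : 0 <= e * (m - s) by rewrite mulr_ge0; lra.
    have kms : 0 <= K * (m - s) by rewrite mulr_ge0; lra.
    lra.
  have [s [sm [as_ gs]]] := filter_ex (filterI (nbhs_left_lt m)
    (filterI (nbhs_left_gt ltam) (Ugood m nUm ltam mb e e_gt0))).
  exists s; split => //; first exact: ltW.
  split; [exact: ltW|lra|].
  have := ler_wpM2l K'0 (VS s m (ltW as_) (ltW sm)); lra.
have [_ _] := Am; rewrite am => /le_trans; apply.
rewrite lerD2l ler_wpM2l//; apply: ge_sup (Vub a (lexx _)).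
by exists 0; exact: variation_sums0.
Qed.

End absolute_continuity.

(** * First-order expansions *)

Section first_order_approximation.
Context {R : realType} {V : normedModType R}.

Lemma derivable_approx (u : R -> V) (t e : R) : derivable u t 1 -> 0 < e ->
  exists2 d : R, 0 < d & forall s, `|s - t| < d ->
    `|u s - u t - (s - t) *: 'D_1 u t| <= e * `|s - t|.
Proof.
move=> du e0.
have /cvgrPdist_le/(_ e e0) :
    (fun h : R => h^-1 *: ((u \o shift t) (h *: 1) - u t)) @ 0^' -->
    'D_1 u t by exact: du.
rewrite /= near_withinE => /nbhs_ballP[d /= d0 H]; exists d => // s std.
have [->|st] := eqVneq s t; first by rewrite !subrr scale0r subrr !normr0 mulr0.
have st0 : s - t != 0 by rewrite subr_eq0.
have := H (s - t); rewrite /ball/= sub0r normrN => /(_ std st0).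
rewrite /= (_ : (s - t) *: 1 + t = s); last by rewrite [_ *: _]mulr1 subrK.
move=> {}H.
have -> : u s - u t - (s - t) *: 'D_1 u t =
    - ((s - t) *: ('D_1 u t - (s - t)^-1 *: (u s - u t))).
  by rewrite scalerBr scalerA divff// scale1r opprB.
by rewrite normrN normrZ mulrC ler_wpM2r.
Qed.

End first_order_approximation.

Lemma powR_le {R : realType} (a x y : R) :
  0 <= a -> 0 <= x -> x <= y -> x `^ a <= y `^ a.
Proof.
by move=> a0 x0 xy; apply: ge0_ler_powR; rewrite ?nnegrE// (le_trans x0).
Qed.

Lemma powR_right_approx {R : realType} (a H e : R) : 0 < H -> 0 < e ->
  exists2 d : R, 0 < d & forall r : R, 0 <= r -> r < d ->
    H `^ a + (a * H `^ (a - 1) - e) * r <= (H + r) `^ a.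
Proof.
move=> H0 e0; have [der Dval] := is_derive1_powR a H0.
have [d d0 Hd] := derivable_approx der e0.
exists d => // r r0 rd; have := Hd (H + r).
rewrite Dval addrAC subrr add0r ger0_norm// => /(_ rd).
rewrite ler_norml => /andP[+ _].
have -> : r *: (a * H `^ (a - 1) : R^o) = r * (a * H `^ (a - 1)) by [].
lra.
Qed.

(** * Steepest descent trajectories *)

Section descent.
Context {R : realType} {X : completeNormedModType R}.
Variable dot : {dot X for (@idfun R)}.
Hypothesis hdot : hilbert_dot dot.
Variables (f : X -> \bar R) (x0 : X) (u : R -> X).
Hypothesis u_descent : steepest_descent dot f x0 u.
Local Notation mu := (@lebesgue_measure R).

Lemma descent_ac a b : 0 <= a -> absolutely_continuous_on a b u.
Proof.
move=> a0; have [_ uac _] := u_descent.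
apply: (absolutely_continuous_onS a0 (_ : b <= `|b| + 1)) (uac _ _).
  by rewrite (le_trans (ler_norm b))// lerDl.
by rewrite ltr_wpDl.
Qed.

Lemma sqr_dist_sub_le (y z w : X) :
  `|z - y| ^+ 2 - `|w - y| ^+ 2 <= 2 * dot (z - y) (z - w).
Proof.
have -> : w - y = (z - y) + (- (z - w)).
  by rewrite opprB [RHS]addrC addrA subrK.
rewrite (normD_sqr hdot (z - y)) dotNr.
by have := sqr_ge0 `|- (z - w)|; lra.
Qed.

(** The left slope of [|u t - y|^2] is at most [2 <u' t, u t - y>], which the
subgradient inequality at [u t], tested at [y], bounds by [2 (f y - f (u t))]. *)
Lemma descent_variational (y : X) (fy a b l : R) : f y = fy%:E ->
    0 <= a -> a <= b ->
    (forall t, a < t -> t <= b -> ((fy - l)%:E <= f (u t))%E) ->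
  `|u b - y| ^+ 2 - `|u a - y| ^+ 2 <= 2 * l * (b - a).
Proof.
move=> fyE a0 ab fl; have uac := descent_ac b a0.
have [M M0 uM] := absolutely_continuous_on_bounded uac.
pose N := M + `|u a - y|.
have N0 : 0 <= N by rewrite addr_ge0.
have uN t : a <= t -> t <= b -> `|u t - y| <= N.
  move=> at_ tb; rewrite -(subrK (u a) (u t)) -addrA.
  by rewrite (le_trans (ler_normD _ _))// lerD// uM.
have N2 : 0 <= 2 * N by rewrite mulr_ge0.
apply: (@left_slope_growth _ _ u a b (2 * N) (2 * l)
  (fun t => `|u t - y| ^+ 2)) => //.
  move=> s t as_ st tb; apply: le_trans (sqr_dist_sub_le _ _ _) _.
  rewrite -mulrA ler_wpM2l//; apply: le_trans (dot_le_norm hdot _ _) _.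
  by rewrite ler_wpM2r// uN// (le_trans as_).
have [_ _ ae_descent] := u_descent.
apply: filterS ae_descent => t ut at_ tb e e0.
have [du sub] := ut (le_lt_trans a0 at_).
have dyl : dot (u t - y) ('D_1 u t) <= l.
  have := sub y; rewrite fyE.
  have -> : dot (- 'D_1 u t) (y - u t) = dot (u t - y) ('D_1 u t).
    by rewrite dotNl -dotNr opprB dotC.
  move=> H; rewrite -(lerD2l (fy - l)) subrK -lee_fin EFinD.
  by apply: le_trans H; rewrite leeD2r// fl.
have e1 : 0 < e / (2 * (N + 1)) by rewrite divr_gt0// mulr_gt0//; lra.
have [d d0 H] := derivable_approx du e1.
near=> s.
have st : s < t by near: s; exact: nbhs_left_lt.
have : `|s - t| < d.
  rewrite ltr0_norm ?subr_lt0// opprB.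
  by near: s; exact: nbhs_left_ltBl.
move=> /H; rewrite ltr0_norm ?subr_lt0// opprB => {}H.
apply: le_trans (sqr_dist_sub_le _ _ _) _.
set r := u s - u t - _ in H.
have -> : u t - u s = (t - s) *: 'D_1 u t - r.
  by rewrite -(opprB s t) scaleNr -opprD /r [in RHS]addrC subrK opprB.
rewrite dotDr dotNr dotZr.
have H1 : - dot (u t - y) r <= N * (e / (2 * (N + 1)) * (t - s)).
  rewrite -dotNr; apply: le_trans (dot_le_norm hdot _ _) _.
  by rewrite normrN; apply: ler_pM => //; apply: uN => //; exact: ltW.
have H2 : (t - s) * dot (u t - y) ('D_1 u t) <= (t - s) * l.
  by rewrite ler_wpM2l// subr_ge0 ltW.
have H3 : 2 * N * (e / (2 * (N + 1))) <= e.
  by rewrite mulrA ler_pdivrMr; nra.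
have H4 : 2 * N * (e / (2 * (N + 1))) * (t - s) <= e * (t - s).
  by rewrite ler_wpM2r// subr_ge0 ltW.
lra.
Unshelve. all: by end_near. Qed.

Hypothesis f_lsc : lower_semicontinuous f.
Hypothesis f_gtNy : forall y, f y != -oo%E.

Lemma lsc_along_descent (a m : R) : 0 <= a -> (m%:E < f (u a))%E ->
  exists2 d : R, 0 < d & forall t, 0 <= t -> `|t - a| < d -> (m%:E < f (u t))%E.
Proof.
move=> a0 /f_lsc[V /nbhs_ballP[r /= r0 rV] Vf].
have [d d0 ud] :=
  absolutely_continuous_on_unif (descent_ac (a + 1) (lexx 0)) r0.
exists (Num.min d 1); first by rewrite lt_min d0/=.
move=> t t0; rewrite lt_min => /andP[td t1]; apply/Vf/rV.
rewrite -ball_normE/=; have := ler_norm (t - a).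
have := ler_norm (- (t - a)); rewrite normrN => ? ?.
have [ta|/ltW ta] := leP t a; first by apply: ud => //; lra.
by rewrite distrC; apply: ud => //; lra.
Qed.

(** If [f (u s) < f (u t)], let [a] be the last time before [t] with
[f (u a) <= f (u s)].  Between [a] and [t], [f \o u] exceeds [f (u a)], so the
variational inequality with [y := u a] forbids [u] to leave [u a]: then
[u t = u a], a contradiction. *)
Lemma descent_nonincreasing s t : 0 <= s -> s <= t -> (f (u t) <= f (u s))%E.
Proof.
move=> s0 st; rewrite leNgt; apply/negP => fst.
have [m fm] : exists m, f (u s) = m%:E.
  exists (fine (f (u s))); rewrite fineK// fin_numE f_gtNy/= lt_eqF//.
  exact: lt_le_trans fst (leey _).
pose E := [set r | [/\ s <= r, r <= t & (f (u r) <= m%:E)%E]].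
have Es : E s by split; rewrite ?fm.
have ubE : ubound E t by move=> r [].
have supE : has_sup E by split; [exists s|exists t].
pose a := sup E.
have sa : s <= a by apply: ub_le_sup => //; exists t.
have at_ : a <= t by apply: ge_sup => //; exists s.
have a0 : 0 <= a by exact: le_trans sa.
have fa : (f (u a) <= m%:E)%E.
  rewrite leNgt; apply/negP => /(lsc_along_descent a0)[d d0 H].
  have [r Er ar] := sup_adherent d0 supE.
  have ra : r <= a by apply: ub_le_sup => //; exists t.
  have [sr _] := Er; rewrite leNgt H//; first exact: le_trans sr.
  by rewrite ler0_norm ?subr_le0// opprB; move: ar; rewrite -/a; lra.
have [fa' faE] : exists y, f (u a) = y%:E.
  exists (fine (f (u a))); rewrite fineK// fin_numE f_gtNy/= lt_eqF//.
  exact: le_lt_trans fa (ltry _).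
have := @descent_variational (u a) fa' a t 0 faE a0 at_.
rewrite subrr normr0 expr0n !subr0 mulr0 mul0r.
move=> H; have : u t = u a.
  apply/eqP; rewrite -subr_eq0 -normr_eq0 -sqrf_eq0 eq_le sqr_ge0 andbT.
  apply: H => r ar rt; rewrite -faE; apply: le_trans fa _.
  rewrite leNgt; apply/negP => /ltW fr; have : r <= a.
    by apply: ub_le_sup; [exists t|split => //; lra].
  lra.
by move=> uta; move: fst; rewrite uta fm ltNge fa.
Qed.

Variables (z : X) (m : R).
Hypothesis fz : f z = m%:E.
Hypothesis z_min : argmin f z.
Hypothesis dom_x0 : dom f x0.

Definition gap t : R := fine (f (u t)) - m.

Lemma gapE t : 0 <= t -> f (u t) = (m + gap t)%:E.
Proof.
move=> t0; rewrite /gap addrC subrK fineK// fin_numE f_gtNy/= lt_eqF//.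
apply: le_lt_trans (descent_nonincreasing (lexx 0) t0) _.
by have [-> _ _] := u_descent.
Qed.

Lemma gap_ge0 t : 0 <= t -> 0 <= gap t.
Proof.
by move=> t0; have := z_min (u t); rewrite fz gapE// lee_fin lerDl.
Qed.

Lemma gap_nonincreasing s t : 0 <= s -> s <= t -> gap t <= gap s.
Proof.
move=> s0 st; have := descent_nonincreasing s0 st.
by rewrite !gapE ?lee_fin ?lerD2l// (le_trans s0).
Qed.

(** The variational inequality tested at a minimizer, where the monotonicity of
the gap lets its final value stand for all earlier ones. *)
Lemma gap_decay t : 0 <= t -> 2 * t * gap t <= `|x0 - z| ^+ 2.
Proof.
move=> t0; have [u0 _ _] := u_descent.
have : `|u t - z| ^+ 2 - `|u 0 - z| ^+ 2 <= 2 * (- gap t) * (t - 0).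
  apply: descent_variational fz (lexx 0) t0 _ => r r0 rt.
  by rewrite (gapE (ltW r0)) lee_fin opprK lerD2l gap_nonincreasing// ltW.
by rewrite u0; have := sqr_ge0 `|u t - z|; lra.
Qed.

(** At [u s], a minimizer, the variational inequality reads
[|u t - u s|^2 <= 0]. *)
Lemma gap0_stationary s t : 0 <= s -> s <= t -> gap s = 0 -> u t = u s.
Proof.
move=> s0 st gs; have fs : f (u s) = m%:E by rewrite gapE// gs addr0.
have : `|u t - u s| ^+ 2 - `|u s - u s| ^+ 2 <= 2 * 0 * (t - s).
  apply: descent_variational fs s0 st _ => r sr rt.
  by rewrite subr0 -fz; exact: z_min.
rewrite subrr normr0 expr0n subr0 mulr0 mul0r => H.
by apply/eqP; rewrite -subr_eq0 -normr_eq0 -sqrf_eq0 eq_le sqr_ge0 H.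
Qed.

Variables (p c : R).
Hypothesis p1 : 1 <= p.
Hypothesis c0 : 0 < c.

(** The desingularizing function [phi]: the Lojasiewicz inequality says that the
slope of [phi \o (f - inf f)] is at least [1]. *)
Definition desing (r : R) : R := p * c * r `^ p^-1.

Let p0 : 0 < p. Proof. exact: lt_le_trans p1. Qed.

Let pc0 : 0 < p * c. Proof. exact: mulr_gt0. Qed.

Lemma desing_ge0 r : 0 <= desing r.
Proof. by rewrite mulr_ge0 ?powR_ge0// ltW. Qed.

Lemma desing_le r s : 0 <= r -> r <= s -> desing r <= desing s.
Proof.
move=> r0 rs; rewrite /desing ler_pM2l//.
by apply: powR_le; rewrite ?invr_ge0 ?(ltW p0).
Qed.

Lemma desing_right_approx (H e : R) : 0 < H -> 0 < e ->
  exists2 d : R, 0 < d & forall r : R, 0 <= r -> r < d ->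
    desing H + (c * H `^ (p^-1 - 1) - e) * r <= desing (H + r).
Proof.
move=> H0 e0; have [d d0 Hd] := powR_right_approx p^-1 H0 (divr_gt0 e0 pc0).
exists d => // r r0 rd; have := Hd r r0 rd; rewrite -(ler_pM2l pc0).
apply: le_trans; rewrite /desing mulrDr lerD2l mulrA ler_wpM2r//.
rewrite mulrBr le_eqVlt; apply/orP; left; apply/eqP; field.
by rewrite !gt_eqF.
Qed.

Lemma desing_small (e : R) : 0 < e ->
  exists2 d : R, 0 < d & forall r : R, 0 <= r -> r <= d -> desing r <= e.
Proof.
move=> e0; exists ((e / (p * c)) `^ p); first exact: powR_gt0 (divr_gt0 e0 pc0).
move=> r r0 rd; apply: le_trans (desing_le r0 rd) _.
rewrite /desing -powRrM divff ?gt_eqF// powRr1 ?(divr_ge0 (ltW e0) (ltW pc0))//.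
by rewrite [leLHS]mulrC divfK ?gt_eqF.
Qed.

(** Only the first time at which a minimizer is reached can be exceptional. *)
Lemma ae_gap0_before :
  {ae mu, forall t, 0 < t -> gap t = 0 ->
    exists s, [/\ 0 <= s, s < t & gap s = 0]}.
Proof.
pose B := [set t | 0 < t /\ gap t = 0 /\ forall s, 0 <= s -> s < t -> gap s <> 0].
have BN t : ~ B t -> 0 < t -> gap t = 0 ->
    exists s, [/\ 0 <= s, s < t & gap s = 0].
  move=> Bt t0 gt; apply: contrapT => H; apply: Bt; split => //; split => //.
  by move=> s s0 st gs; apply: H; exists s.
have [t0 Bsub] : exists t0, forall t, B t -> t = t0.
  have [[t0 Bt0]|B0] := pselect (exists t, B t); last first.
    by exists 0 => t Bt; case: B0; exists t.
  exists t0 => t [t_gt0 [gt H]]; have [t0_gt0 [gt0 H0]] := Bt0.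
  have [tt|tt|//] := ltgtP t t0.
    by case: (H0 t (ltW t_gt0) tt gt).
  by case: (H t0 (ltW t0_gt0) tt gt0).
exists [set t0]; split; first exact: measurable_set1.
  exact: lebesgue_measure_set1.
by move=> t /= nt; apply: contrapT => tt0; apply/nt/BN => /Bsub.
Qed.

(** Once a minimizer has been reached before [t], everything is constant near [t].
Otherwise, with [w := |u' t|] and [k := phi' (gap t)], the subgradient inequality
at [u t] tested at [u s] gives [gap s >= gap t + (t - s) * w^2] to first order, so
that [phi (gap s) - phi (gap t) >= k * w^2 * (t - s) >= w * (t - s)] to first
order since [k * w >= 1], whereas [|u t - u s|] is [w * (t - s)] to first
order. *)
Lemma desing_left_slope (t s0 e : R) : 0 < t -> derivable u t 1 ->
    subdiff dot f (u t) (- 'D_1 u t) ->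
    (0 < gap t -> gap t `^ (1 - p^-1) <= c * `|'D_1 u t|) ->
    (gap t = 0 -> exists s, [/\ 0 <= s, s < t & gap s = 0]) ->
    0 < e ->
  \forall s \near t^'-, (`|u t - u s0| + desing (gap t)) -
    (`|u s - u s0| + desing (gap s)) <= e * (t - s).
Proof.
move=> t0 du sub loj stat e0.
suff H : \forall s \near t^'-,
    `|u t - u s| + desing (gap t) - desing (gap s) <= e * (t - s).
  apply: filterS H => s; apply: le_trans.
  have : `|u t - u s0| <= `|u t - u s| + `|u s - u s0|.
    by rewrite -[u t - u s0](subrKA (u s)) ler_normD.
  lra.
have := gap_ge0 (ltW t0); rewrite le_eqVlt => /predU1P[/esym gt|gt].
  have [s1 [s10 s1t gs1]] := stat gt.
  near=> s; have s1s : s1 < s by near: s; exact: nbhs_left_gt.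
  have st : s < t by near: s; exact: nbhs_left_lt.
  have s_ge0 : 0 <= s by apply: le_trans (ltW s1s).
  have gs : gap s = 0.
    by apply/eqP; rewrite eq_le gap_ge0// -gs1 gap_nonincreasing// ltW.
  rewrite (gap0_stationary s_ge0 (ltW st) gs) subrr normr0 add0r gs gt subrr.
  by apply: mulr_ge0; [exact: ltW|rewrite subr_ge0 ltW].
set G := gap t in gt loj *; set D := 'D_1 u t in sub loj *; pose w := `|D|.
pose k := c * G `^ (p^-1 - 1).
have kw : 1 <= k * w.
  have GG : G `^ (p^-1 - 1) * G `^ (1 - p^-1) = 1.
    rewrite -powRD; last by rewrite (gt_eqF gt) implybT.
    by rewrite addrA subrK subrr powRr0.
  rewrite -[leLHS]GG /k [leRHS]mulrAC [leRHS]mulrC ler_wpM2l ?powR_ge0//; exact: loj.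
have w0 : 0 < w.
  rewrite lt_neqAle normr_ge0 andbT; apply/eqP => w0.
  by move: kw; rewrite -w0 mulr0 ler10.
have k0 : 0 < k by rewrite mulr_gt0 ?powR_gt0.
have kw1 : 0 < 2 * (1 + k * w) by rewrite mulr_gt0//; lra.
(* [h] and [e2] are the errors allowed in the expansions of [u] and of [phi];
   they contribute [h * (1 + k * w)] and [e2 * w ^+ 2] to the slope, half of [e]
   each. *)
pose h := Num.min w (e / (2 * (1 + k * w))).
have h0 : 0 < h by rewrite lt_min w0 divr_gt0.
have hw : h <= w by rewrite ge_min lexx.
have he : h * (1 + k * w) <= e / 2.
  have : h <= e / (2 * (1 + k * w)) by rewrite ge_min lexx orbT.
  by rewrite ler_pdivlMr//; lra.
have w2 : 0 < w ^+ 2 by rewrite exprn_gt0.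
pose e2 := e / (2 * w ^+ 2).
have e20 : 0 < e2 by rewrite divr_gt0// mulr_gt0.
have e2w : e2 * w ^+ 2 = e / 2 by rewrite /e2; field; rewrite gt_eqF.
have [d d0 ud] := derivable_approx du h0.
have [d' d'0 phid] := desing_right_approx gt e20.
near=> s.
have st : s < t by near: s; exact: nbhs_left_lt.
have s_ge0 : 0 <= s by near: s; exact: nbhs_left_ge.
have ts0 : 0 < t - s by rewrite subr_gt0.
have tsd' : t - s < d' / w ^+ 2.
  by near: s; apply: nbhs_left_ltBl; rewrite divr_gt0.
have : `|s - t| < d.
  by rewrite distrC ger0_norm ?ltW//; near: s; exact: nbhs_left_ltBl.
move=> /ud; rewrite [`|s - t|]distrC [`|t - s|]ger0_norm ?(ltW ts0)//.
rewrite -/D; set r := u s - u t - _ => rh.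
have ruE : u t - u s = (t - s) *: D - r.
  by rewrite -(opprB s t) scaleNr -opprD /r [in RHS]addrC subrK opprB.
have unorm : `|u t - u s| <= (t - s) * (w + h).
  rewrite ruE (le_trans (ler_normB _ _))// normrZ ger0_norm ?(ltW ts0)//.
  by rewrite mulrDr lerD2l mulrC.
have gs : G + (t - s) * (w * (w - h)) <= gap s.
  have := sub (u s); rewrite !gapE// ?(ltW t0)// -EFinD lee_fin -addrA lerD2l.
  apply: le_trans; rewrite lerD2l dotNl -dotNr opprB ruE dotDr dotNr dotZr.
  rewrite hdot -/w.
  have : dot D r <= w * (h * (t - s)).
    by rewrite (le_trans (dot_le_norm hdot _ _))// ler_wpM2l.
  lra.
have tau0 : 0 <= (t - s) * (w * (w - h)).
  by rewrite mulr_ge0 ?(ltW ts0)// mulr_ge0 ?(ltW w0)// subr_ge0.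
have taud : (t - s) * (w * (w - h)) < d'.
  move: tsd'; rewrite ltr_pdivlMr//; apply: le_lt_trans.
  by rewrite ler_wpM2l ?(ltW ts0)// expr2 ler_wpM2l ?(ltW w0)// lerBlDr lerDl ltW.
have phis := desing_le (addr_ge0 (ltW gt) tau0) gs.
have := le_trans (phid _ tau0 taud) phis; rewrite -/k => phi.
suff : (t - s) * (w + h) - (k - e2) * ((t - s) * (w * (w - h))) <= e * (t - s).
  lra.
have -> : (t - s) * (w + h) - (k - e2) * ((t - s) * (w * (w - h))) =
  (t - s) * (w * (1 - k * w) + h * (1 + k * w) + e2 * w ^+ 2 - e2 * w * h).
  by ring.
rewrite [leRHS]mulrC. rewrite ler_wpM2l ?(ltW ts0)//. rewrite e2w.
have : w * (1 - k * w) <= 0 by rewrite mulr_ge0_le0 ?(ltW w0)// subr_le0.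
have : 0 <= e2 * w * h by exact: mulr_ge0 (mulr_ge0 (ltW e20) (ltW w0)) (ltW h0).
lra.
Unshelve. all: by end_near. Qed.

Hypothesis descent_lojasiewicz : {ae mu, forall t, 0 < t ->
  0 < gap t -> gap t `^ (1 - p^-1) <= c * `|'D_1 u t|}.

Lemma descent_length s t : 0 <= s -> s <= t ->
  `|u t - u s| + desing (gap t) <= desing (gap s).
Proof.
move=> s0 st.
have : (`|u t - u s| + desing (gap t)) - (`|u s - u s| + desing (gap s)) <=
    0 * (t - s).
  apply: (@left_slope_growth _ _ u s t 1 0
    (fun r => `|u r - u s| + desing (gap r))) => //.
  - exact: descent_ac.
  - move=> r r' sr rr' r't; rewrite mul1r.
    have r0 : 0 <= r by exact: le_trans sr.
    have : desing (gap r') <= desing (gap r).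
      apply: desing_le; first exact/gap_ge0/(le_trans r0).
      exact: gap_nonincreasing.
    have : `|u r' - u s| <= `|u r' - u r| + `|u r - u s|.
      by rewrite -[u r' - u s](subrKA (u r)) ler_normD.
    lra.
  have [_ _ ae_descent] := u_descent.
  apply: filterS3 ae_descent descent_lojasiewicz ae_gap0_before.
  move=> r ur lojr statr sr rt e e0; rewrite add0r.
  have r0 : 0 < r by exact: le_lt_trans sr.
  have [du sub] := ur r0.
  by apply: desing_left_slope => //; [exact: lojr|exact: statr].
by rewrite subrr normr0 add0r mul0r; lra.
Qed.

(** By [descent_length], [|u t - u s| <= phi (gap s)], which tends to zero: [u] is
Cauchy, and lower semicontinuity makes its limit a minimizer. *)
Lemma descent_limit :
  exists2 y : X, argmin f y & `|y - x0| <= desing (gap 0).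
Proof.
have gap_small (e : R) : 0 < e -> exists2 T : R, 0 < T & gap T <= e.
  move=> e0; have C0 := sqr_ge0 `|x0 - z|.
  exists (`|x0 - z| ^+ 2 / (2 * e) + 1).
    by rewrite ltr_wpDl// divr_ge0// ltW// mulr_gt0.
  set T := _ + 1.
  have T0 : 0 < T by rewrite ltr_wpDl// divr_ge0// ltW// mulr_gt0.
  have := gap_decay (ltW T0) => gT.
  have : `|x0 - z| ^+ 2 <= 2 * T * e.
    have : `|x0 - z| ^+ 2 / (2 * e) * (2 * e) = `|x0 - z| ^+ 2.
      by rewrite divfK// gt_eqF// mulr_gt0.
    by rewrite /T; lra.
  move=> /(le_trans gT); rewrite ler_pM2l// mulr_gt0//.
have ev_gap e : 0 < e -> \forall t \near +oo, 0 <= t /\ gap t <= e.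
  move=> e0; have [T T0 gT] := gap_small e e0.
  near=> t; have Tt : T <= t by near: t; apply: nbhs_pinfty_ge; exact: num_real.
  split; first by apply: le_trans Tt; exact: ltW.
  by apply: le_trans gT; apply: gap_nonincreasing => //; exact: ltW.
have cvgu : cvg (u t @[t --> +oo]).
  apply: cauchy_cvg; apply: cauchy_exP => e e0.
  have e2 : 0 < e / 2 by rewrite divr_gt0.
  have [d d0 phid] := desing_small e2.
  have [T T0 gT] := gap_small d d0.
  exists (u T); suff : \forall t \near +oo, ball (u T) e (u t) by [].
  near=> t.
  have Tt : T <= t by near: t; apply: nbhs_pinfty_ge; exact: num_real.
  rewrite -ball_normE/= distrC.
  have := descent_length (ltW T0) Tt; have := desing_ge0 (gap t).
  by have := phid _ (gap_ge0 (ltW T0)) gT; lra.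
have [y uy] : exists y : X, u t @[t --> +oo] --> y.
  by exists (lim (u t @[t --> +oo])); exact: cvgu.
have [u0 _ _] := u_descent.
exists y; last first.
  apply/ler_addgt0Pr => e e0; have /cvgrPdist_lt/(_ e e0) uye := uy.
  have [t [t0 ut]] := filter_ex (filterI
    (nbhs_pinfty_ge (num_real 0)) uye).
  have := descent_length (lexx 0) t0; have := desing_ge0 (gap t).
  have : `|y - x0| <= `|y - u t| + `|u t - x0|.
    by rewrite -[y - x0](subrKA (u t)) ler_normD.
  by move: ut; rewrite /= u0; lra.
suff fy : (f y <= m%:E)%E.
  by move=> v; apply: le_trans fy _; rewrite -fz; exact: z_min.
rewrite leNgt; apply/negP => my.
have [r mr ry] : exists2 r : R, m < r & (r%:E < f y)%E.
  case: (f y) my => [r| |//]; last by exists (m + 1); rewrite ?ltrDl ?ltry.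
  rewrite lte_fin => mr; exists ((m + r) / 2); rewrite ?lte_fin; lra.
have [V Vy Vf] := f_lsc ry.
have rm : 0 < r - m by rewrite subr_gt0.
have [t [[t0 gt] Vt]] := filter_ex (filterI (ev_gap _ rm) (uy _ Vy)).
by have := Vf _ Vt; rewrite gapE// lte_fin; lra.
Unshelve. all: by end_near. Qed.

End descent.

(** * Conditioning, subregularity and the Lojasiewicz inequality *)

Section distance.
Context {R : realType} {X : completeNormedModType R}.
Implicit Types (A : set X) (x a : X).

Lemma edist_inf_le A x a : A a -> (edist_inf A x <= `|x - a|%:E)%E.
Proof. by move=> Aa; rewrite -edist_norm; apply: ereal_inf_lbound; exists a. Qed.

Lemma le_edist_inf A x (y : \bar R) :
  (forall a, A a -> (y <= `|x - a|%:E)%E) -> (y <= edist_inf A x)%E.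
Proof.
by move=> H; apply: le_ereal_inf_tmp => _ /= [a Aa <-]; rewrite edist_norm H.
Qed.

Lemma edist_inf_EFin A x : A !=set0 ->
  exists2 d : R, 0 <= d & edist_inf A x = d%:E.
Proof.
move=> [a Aa]; have := edist_inf_le x Aa; have := edist_inf_ge0 A x.
case: (edist_inf A x) => [d| |]//; by rewrite lee_fin; exists d.
Qed.

End distance.

Section conditioning.
Context {R : realType} {X : completeNormedModType R}.
Variable dot : {dot X for (@idfun R)}.
Hypothesis hdot : hilbert_dot dot.
Variables (f : X -> \bar R) (p : R) (Om : set X).
Hypothesis p1 : 1 <= p.
Hypothesis f_proper : Defs.proper f.
Hypothesis f_argmin : argmin f !=set0.

Let p0 : 0 < p. Proof. exact: lt_le_trans p1. Qed.

Lemma inf_valE z : argmin f z -> inf_val f = f z.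
Proof.
move=> fz; apply/eqP; rewrite eq_le; apply/andP; split.
  by apply: ereal_inf_lbound; exists z.
by apply: le_ereal_inf_tmp => _ /= [y _ <-]; exact: fz.
Qed.

Lemma dom_EFin x : dom f x -> exists r : R, f x = r%:E.
Proof.
rewrite /dom/= => fx; exists (fine (f x)).
rewrite fineK// fin_numE (lt_eqF fx) andbT.
by have [] := f_proper.
Qed.

Lemma argmin_EFin z : argmin f z -> exists m : R, f z = m%:E.
Proof.
move=> fz; apply: dom_EFin; have [_ [y fy]] := f_proper.
exact: le_lt_trans (fz y) fy.
Qed.

(** The finite quantities behind the three properties at a point of [dom_star f].
The bound [g <= |v| * d] is the subgradient inequality tested at all minimizers;
with [0 < g], it also shows that the distance [d] is positive. *)
Lemma dom_starP x : dom_star f x -> exists2 g : R, 0 < g &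
  (f x - inf_val f)%E = g%:E /\
  forall v, subdiff dot f x v -> exists2 d : R, 0 < d &
    edist_inf (argmin f) x = d%:E /\ g <= `|v| * d.
Proof.
move=> [fx nfx]; have [z fz] := f_argmin.
have [m mE] := argmin_EFin fz; have [r rE] := dom_EFin fx.
have mr : m < r.
  rewrite ltNge; apply/negP => rm; apply: nfx => y.
  by apply: le_trans (fz y); rewrite rE mE lee_fin.
exists (r - m); rewrite ?subr_gt0//; split; first by rewrite (inf_valE fz) rE mE.
move=> v vx; have [d d0 dE] := edist_inf_EFin x f_argmin.
have gv a : argmin f a -> r - m <= `|v| * `|x - a|.
  move=> fa; have := vx a.
  rewrite -(inf_valE fa) (inf_valE fz) rE mE -EFinD lee_fin -opprB dotNr.
  by have := dot_le_norm hdot v (x - a); lra.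
have v0 : 0 < `|v|.
  rewrite lt_neqAle normr_ge0 andbT; apply/eqP => v0.
  by have := gv z fz; rewrite -v0 mul0r; lra.
have gd : r - m <= `|v| * d.
  rewrite mulrC -ler_pdivrMr// -lee_fin -dE; apply: le_edist_inf => a fa.
  by rewrite lee_fin ler_pdivrMr// mulrC gv.
exists d => //; rewrite lt_neqAle d0 andbT; apply/eqP => d00.
by move: gd; rewrite -d00 mulr0; lra.
Qed.

Lemma slope_le x v : subdiff dot f x v -> (slope dot f x <= `|v|%:E)%E.
Proof. by move=> /(edist_inf_le 0); rewrite sub0r normrN. Qed.

Lemma le_slope x (y : \bar R) :
  (forall v, subdiff dot f x v -> (y <= `|v|%:E)%E) -> (y <= slope dot f x)%E.
Proof. by move=> H; apply: le_edist_inf => v; rewrite sub0r normrN; exact: H. Qed.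

Lemma conditioned_subregular g :
  conditioned_with f p Om g -> subregular_with dot f p Om (g / p).
Proof.
move=> [g0 fg]; split; first exact: divr_gt0.
move=> x Omx sx; have [h h0 [hE hv]] := dom_starP sx.
apply: le_slope => v /hv[d d0 [dE hd]].
have := fg x Omx sx.1; rewrite hE dE !poweR_EFin -!EFinM !lee_fin => H.
rewrite -(ler_pM2r d0); apply: le_trans hd; apply: le_trans H.
rewrite -mulrA ler_wpM2l ?(divr_ge0 (ltW g0) (ltW p0))//.
by rewrite -{2}(powRr1 (ltW d0)) -powRD ?subrK// (gt_eqF d0) implybT.
Qed.

Lemma subregular_lojasiewicz g :
  subregular_with dot f p Om g -> lojasiewicz_with dot f p Om (g `^ (- p^-1)).
Proof.
move=> [g0 fg]; have c0 : 0 < g `^ (- p^-1) by exact: powR_gt0.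
split => // x Omx sx; have [h h0 [hE hv]] := dom_starP sx.
rewrite -lee_pdivrMl//; apply: le_slope => v vx.
have [d d0 [dE hd]] := hv v vx.
have := le_trans (fg x Omx sx) (slope_le vx).
rewrite hE dE !poweR_EFin -!EFinM !lee_fin => gv.
rewrite ler_pdivrMl//; set w := `|v| in hd gv *.
have w0 : 0 < w by rewrite -(pmulr_lgt0 _ d0); exact: lt_le_trans hd.
have q0 : 0 <= 1 - p^-1 by rewrite subr_ge0 invf_le1.
have dp : d `^ (1 - p^-1) <= w `^ p^-1 * g `^ (- p^-1).
  have -> : d `^ (1 - p^-1) = (d `^ (p - 1)) `^ p^-1.
    by rewrite -powRrM mulrBl mul1r divff// gt_eqF.
  rewrite powRN ler_pdivlMr ?powR_gt0//.
  rewrite -powRM ?powR_ge0 ?(ltW g0)//.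
  apply: powR_le; first by rewrite invr_ge0 ltW.
    by rewrite mulr_ge0 ?powR_ge0// ltW.
  by rewrite mulrC.
have hq : h `^ (1 - p^-1) <= (w * d) `^ (1 - p^-1).
  by apply: powR_le => //; exact: ltW.
apply: le_trans hq _; rewrite powRM ?(ltW w0) ?(ltW d0)//.
have -> : g `^ (- p^-1) * w = w `^ (1 - p^-1) * (w `^ p^-1 * g `^ (- p^-1)).
  rewrite mulrA -powRD; last by rewrite (gt_eqF w0) implybT.
  by rewrite subrK powRr1 ?(ltW w0)// mulrC.
by rewrite ler_wpM2l ?powR_ge0.
Qed.

Hypothesis f_lsc : lower_semicontinuous f.

(** Invariance is used for one set [D] of starting points at a time, which covers
both notions of invariance. *)
Lemma lojasiewicz_conditioned (D : set X) c :
    flow_invariant_from dot f D Om -> lojasiewicz_with dot f p Om c ->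
  conditioned_with f p (Om `&` D) (c `^ (- p) * p `^ (1 - p)).
Proof.
move=> Om_inv [c0 loj]; have C0 : 0 < c `^ (- p) * p `^ (1 - p).
  by rewrite mulr_gt0 ?powR_gt0.
split => // x [Omx Dx] fx; have [u u_descent Omu] := Om_inv x Omx Dx.
have [z fz] := f_argmin; have [m mE] := argmin_EFin fz.
have f_gtNy : forall y, f y != -oo%E by have [] := f_proper.
have gapP := gapE hdot u_descent f_lsc f_gtNy m fx.
have loju : {ae @lebesgue_measure R, forall t, 0 < t -> 0 < gap f u m t ->
    gap f u m t `^ (1 - p^-1) <= c * `|'D_1 u t|}.
  have [_ _ ae_descent] := u_descent.
  apply: filterS2 ae_descent Omu => t ut Omt t0 gt.
  have [_ /slope_le] := ut t0; rewrite normrN => sD.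
  have st : dom_star f (u t).
    split; first by rewrite /dom/= gapP ?ltry// ltW.
    move=> /(_ z); rewrite mE gapP ?(ltW t0)// lee_fin; lra.
  have := loj _ (Omt t0) st.
  rewrite (inf_valE fz) mE gapP ?(ltW t0)// -EFinB addrAC subrr add0r.
  rewrite poweR_EFin -lee_fin EFinM => /le_trans; apply.
  by rewrite lee_pmul2l// lte_fin.
have [y fy yx] := descent_limit hdot u_descent f_lsc f_gtNy mE fz fx p1 c0 loju.
have [u0 _ _] := u_descent.
have gx : f x = (m + gap f u m 0)%:E by rewrite -gapP// u0.
have g0 := gap_ge0 hdot u_descent f_lsc f_gtNy mE fz fx (lexx 0).
rewrite (inf_valE fz) mE gx -EFinB addrAC subrr add0r.
have [d d0 dE] := edist_inf_EFin x f_argmin.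
have dle : d <= p * c * gap f u m 0 `^ p^-1.
  rewrite -lee_fin -dE; apply: le_trans (edist_inf_le x fy) _.
  by rewrite lee_fin distrC.
rewrite dE poweR_EFin -EFinM lee_fin.
have pc0 : 0 < p * c by rewrite mulr_gt0.
have dp : d `^ p <= p `^ p * c `^ p * gap f u m 0.
  apply: (@le_trans _ _ ((p * c * gap f u m 0 `^ p^-1) `^ p)).
    by apply: powR_le => //; exact: ltW.
  rewrite powRM ?powR_ge0 ?(ltW pc0)// powRM ?(ltW p0) ?(ltW c0)//.
  by rewrite -powRrM mulVf ?gt_eqF// powRr1.
apply: le_trans (ler_wpM2l (divr_ge0 (ltW C0) (ltW p0)) dp) _.
rewrite le_eqVlt; apply/orP; left; apply/eqP.
have p1p : p `^ (1 - p) * p `^ p = p.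
  by rewrite -powRD ?subrK ?powRr1 ?(ltW p0)// (gt_eqF p0) implybT.
have ccp : c `^ (- p) * c `^ p = 1.
  by rewrite -powRD ?addNr ?powRr0// (gt_eqF c0) implybT.
have -> : c `^ (- p) * p `^ (1 - p) / p * (p `^ p * c `^ p * gap f u m 0) =
  (c `^ (- p) * c `^ p) * (p `^ (1 - p) * p `^ p) / p * gap f u m 0 by ring.
by rewrite p1p ccp mul1r divff ?mul1r// gt_eqF.
Qed.

End conditioning.

Unset Implicit Arguments.

Theorem proposition3p3 (R : realType) (X : completeNormedModType R)
    (dot : {dot X for (@idfun R)}) (hdot : hilbert_dot dot)
    (p : R) (hp : 1 <= p) (Om : set X)
    (f : X -> \bar R) (hf : Gamma0 f) (hmin : argmin f !=set0) :
  [/\ (* (i) => (ii) *)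
      (conditioned f p Om -> subregular dot f p Om) /\
      (forall g, conditioned_with f p Om g ->
         subregular_with dot f p Om (g / p)),
      (* (ii) => (iii) *)
      (subregular dot f p Om -> lojasiewicz dot f p Om) /\
      (forall g, subregular_with dot f p Om g ->
         lojasiewicz_with dot f p Om (g `^ (- p^-1))),
      (* (iii) => (i) at the points of dom_subdiff f *)
      subdiff_invariant dot f Om ->
        (lojasiewicz dot f p Om ->
           conditioned f p (Om `&` dom_subdiff dot f)) /\
        (forall c, lojasiewicz_with dot f p Om c ->
           conditioned_with f p (Om `&` dom_subdiff dot f)
             (c `^ (- p) * p `^ (1 - p)))
    & (* (iii) => (i) *)
      dom_invariant dot f Om ->
        (lojasiewicz dot f p Om -> conditioned f p Om) /\
        (forall c, lojasiewicz_with dot f p Om c ->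
           conditioned_with f p Om (c `^ (- p) * p `^ (1 - p)))].
Proof.
have [f_proper _ f_lsc] := hf.
have i_ii := conditioned_subregular hdot hp f_proper hmin (Om := Om).
have ii_iii := subregular_lojasiewicz hdot hp f_proper hmin (Om := Om).
have iii_i D := lojasiewicz_conditioned hdot hp f_proper hmin f_lsc
  (Om := Om) (D := D).
split.
- by split => [[g /i_ii]|//]; exists (g / p).
- by split => [[g /ii_iii]|//]; exists (g `^ (- p^-1)).
- move=> inv; split => [[c]|c]; last exact: iii_i.
  by move=> /(iii_i _ _ inv); exists (c `^ (- p) * p `^ (1 - p)).
- move=> inv; have {}iii_i c : lojasiewicz_with dot f p Om c ->
      conditioned_with f p Om (c `^ (- p) * p `^ (1 - p)).
    by move=> /(iii_i _ _ inv)[C0 H]; split => // x Omx fx; exact: H.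
  split => [[c /iii_i]|//]; by exists (c `^ (- p) * p `^ (1 - p)).
Qed.
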